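(* Let $P$ be a poset. There are semigroups $S<T$ such that $P\cong P(T,S)$ if and only if there is a subsemigroup $L<\mathrm{End}(P)$ and an upset $F\subseteq P$ such that for every element $x\in P$ there is a unique $\varphi_x\in L$ such that $\varphi_x(F)=\,\uparrow\! x$. Moreover, in this case $S=F$ and $L=L(T)$.
   Context: For semigroups, $S<T$ means that $S$ is a subsemigroup of $T$ (equality $S=T$ is allowed). On $T$ define $t\leq_S t' :\iff \exists s\in S:\ ts=t'$. The notation $P(T,S)$ is used only when $\leq_S$ is an order relation on $T$, and then denotes the poset $(T,\leq_S)$. $\mathrm{End}(P)$ is the monoid of order endomorphisms (order-preserving self-maps) of $P$ under composition. An upset of $P$ is an upward closed subset of $P$, and $\uparrow\! x=\{y\in P\mid x\leq y\}$ is the principal upset of $x$. For a semigroup $T$, $L(T)=\{\varphi_t\mid t\in T\}$, where $\varphi_t:T\to T$, $\varphi_t(x)=tx$, is left-multiplication by $t$.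
   Formalization: The condition on L and F additionally requires that every element of L maps F onto a principal upset (so L consists exactly of the maps φ_x); without this the ''if'' direction fails for a 7-element poset, and L = L(T) would fail as well. *)

(* Defs.v *)
From mathcomp Require Import all_boot all_order.
From mathcomp Require Import boolp classical_sets.

Set Implicit Arguments.
Unset Strict Implicit.
Unset Printing Implicit Defensive.

Local Open Scope classical_set_scope.
Local Open Scope order_scope.

Section CayleyPoset.
Variable T : semigroupType.

Definition subsemigroup (S : set T) : Prop :=
  forall s t, S s -> S t -> S (s * t)%g.

Definition cayley_le (S : set T) (t t' : T) : Prop :=
  exists s, S s /\ (t * s)%g = t'.

Definition left_mul (t : T) : T -> T := fun x => (t * x)%g.

Definition left_muls : set (T -> T) := range left_mul.

End CayleyPoset.

Arguments left_muls T : clear implicits.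

Section Posets.
Context {d : Order.disp_t} {P : porderType d}.

Definition up (x : P) : set P := [set y | x <= y].

Definition upset (F : set P) : Prop := forall x y, F x -> x <= y -> F y.

Definition order_endos : set (P -> P) :=
  [set phi | Order.nondecreasing phi].

Definition subsemigroup_endos (L : set (P -> P)) : Prop :=
  L `<=` order_endos /\
  (forall phi psi, L phi -> L psi -> L (phi \o psi)).

(* The last clause says that L consists of the maps phi_x only, as it does
   when L = L(T) and F = S.  It does not follow from the other clauses: on
   the chain 0 < 1 with F = P they also hold for the three-element monoid
   End(P), which is not L(T) for any T of order 2.  Nor do the other clauses
   alone imply that P is isomorphic to some P(T,S): they hold, with F = P
   and L generated by the phi_x, for the poset
     0 < a, e, f;  a < b, c, d;  e < b, c;  f < c, d,
   where phi_0 = id, each maximal m has phi_m constantly m, and for x = a, e, f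
   the map phi_x is constantly x on {0, a, e, f} and sends (b, c, d) to
   (b, c, d), (b, c, c), (c, c, d) respectively.  This poset is no P(T,S): 0S = P forces S = P, and
   since a(up y) = up (ay) for all y, the upsets of e and f force
   ab = ac = ad, so that aS is not up a. *)
Definition representing (L : set (P -> P)) (F : set P) : Prop :=
  [/\ subsemigroup_endos L,
      upset F,
      forall x : P, exists! phi : P -> P, L phi /\ phi @` F = up x
    & forall phi, L phi -> exists x : P, phi @` F = up x].

(* f is an isomorphism from P onto P(T,S); the clause on cayley_le S is the
   condition for the notation P(T,S) to be meaningful. *)
Definition cayley_iso (T : semigroupType) (S : set T) (f : P -> T) : Prop :=
  [/\ Relation_Definitions.order T (cayley_le S),
      bijective f
    & forall x y : P, x <= y <-> cayley_le S (f x) (f y)].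

(* For bijective f this is the set of all f \o phi \o f^-1 with phi in L. *)
Definition transport (T : Type) (f : P -> T) (L : set (P -> P)) :
    set (T -> T) :=
  [set psi : T -> T | exists2 phi, L phi & psi \o f = f \o phi].

End Posets.

(* Main.v *)
Require Import Defs.
From HB Require Import structures.
From mathcomp Require Import all_boot all_order.
From mathcomp Require Import boolp classical_sets.

Import Order.TTheory.

(** A multiplication on [T] is the same as the assignment to each [t] of the left
    multiplication by [t], and in the poset [P(T,S)] this map is marked by [t]:
    it sends [S] onto [t * S], which is the principal upset of [t].

    Given [T] and [S], transport left multiplication along the isomorphism:
    [phi_x] is [y |-> x * y] and [F] corresponds to [S].  Each [phi_x] is monotone because
    [y * s = y'] implies [(x * y) * s = x * y'], and antisymmetry makes [x] the
    only element whose principal upset is [x * S] ([left_mul_representing]).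

    Given [L] and [F], let [phi_x] be the member of [L] sending [F] onto the
    principal upset of [x], and put [x * y := phi_x y].  The point is
    associativity, that is, [phi_x \o phi_y = phi_(phi_x y)].  The left-hand
    side lies in [L], so it maps [F] onto a principal upset, that of [z] say.
    As it also maps [F] onto the image under [phi_x] of the principal upset of
    [y], whose least element is [phi_x y] by monotonicity, [z] is [phi_x y]
    ([image_up_least]), and uniqueness of [phi_z] gives the equality.  Finally
    [x * F] is by construction the principal upset of [x], so [<=] is the order
    defined by [F]. *)

Local Open Scope classical_set_scope.
Local Open Scope order_scope.

(** The semigroup carried by [A] with multiplication [op]; it is a new name for
    [A], so that any multiplication already on [A] plays no role. *)
Definition semigroup_of {A : choiceType} {op : A -> A -> A}
  (opA : associative op) : Type := A.

HB.instance Definition _ (A : choiceType) (op : A -> A -> A)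
    (opA : associative op) :=
  Choice.on (semigroup_of opA).
HB.instance Definition _ (A : choiceType) (op : A -> A -> A)
    (opA : associative op) :=
  hasMul.Build (semigroup_of opA) op.
HB.instance Definition _ (A : choiceType) (op : A -> A -> A)
    (opA : associative op) :=
  Magma_isSemigroup.Build (semigroup_of opA) opA.

Section Posets.
Context {d : Order.disp_t} {P : porderType d}.

Lemma up_inj : injective (@up d P).
Proof.
move=> x y exy; apply/le_anti/andP; split.
- have : up y y by exact: lexx.
  by rewrite -exy.
- have : up x x by exact: lexx.
  by rewrite exy.
Qed.

(** This identifies the member of [L] that a composite [phi_x \o phi_y] is, and
    so carries associativity of the multiplication built from [L]. *)
Lemma image_up_least {phi : P -> P} {y z : P} :
  Order.nondecreasing phi -> phi @` up y = up z -> phi y = z.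
Proof.
move=> phi_mono e; apply/le_anti/andP; split.
- have [w yw <-] : (phi @` up y) z by rewrite e; exact: lexx.
  exact: phi_mono.
- have : (phi @` up y) (phi y) by exists y => //; exact: lexx.
  by rewrite e.
Qed.

Lemma left_mul_representing {T : semigroupType} {S : set T} {f : P -> T} :
  subsemigroup S -> cayley_iso S f ->
  exists (L : set (P -> P)) (F : set P),
    [/\ representing L F, S = f @` F & transport f L = left_muls T].
Proof.
move=> Ssub [_ [g fK gK] f_le].
pose phi t : P -> P := g \o left_mul t \o f.
have phi_mono t : Order.nondecreasing (phi t).
  move=> x y /f_le[s [Ss e]]; apply/f_le; exists s; split=> //.
  by rewrite /phi /= !gK /left_mul -mulgA e.
have phi_up t : phi t @` (g @` S) = up (g t).
  apply/seteqP; split=> [_ [_ [s Ss <-] <-]|y /f_le[s [Ss e]]].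
    by apply/f_le; exists s; split; rewrite // /phi /= !gK.
  exists (g s); first by exists s.
  by rewrite /phi /= gK /left_mul -(fK y) -e gK.
exists (range phi), (g @` S); split.
- split.
  + split=> [_ [t _ <-]|_ _ [t _ <-] [u _ <-]]; first exact: phi_mono.
    exists (t * u)%g => //; apply/funext => x.
    by rewrite /phi /= gK /left_mul mulgA.
  + move=> _ y [s Ss <-] /f_le[s' [Ss' e]]; exists (s * s')%g.
      exact: Ssub.
    by rewrite -(fK y) -e gK.
  + move=> x; exists (phi (f x)); split.
      by split; [exists (f x) | rewrite phi_up fK].
    move=> _ [[t _ <-]]; rewrite phi_up => /up_inj <-.
    by rewrite gK.
  + by move=> _ [t _ <-]; exists (g t).
- apply/seteqP; split=> [s Ss|_ [_ [s Ss <-] <-]]; last by rewrite gK.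
  by exists (g s); [exists s | rewrite gK].
- apply/seteqP; split=> [psi [_ [t _ <-] e]|_ [t _ <-]].
    exists t => //; apply/funext => u; rewrite -(gK u).
    by have /= -> := congr1 (@^~ (g u)) e; rewrite /phi /= gK.
  exists (phi t); first by exists t.
  by apply/funext => x; rewrite /phi /= gK.
Qed.

Lemma representing_semigroup {L : set (P -> P)} {F : set P} :
  representing L F ->
  exists (T : semigroupType) (S : set T) (f : P -> T),
    [/\ subsemigroup S, cayley_iso S f,
        S = f @` F & transport f L = left_muls T].
Proof.
move=> [[Lmono Lcomp] Fup Luniq Lup].
have [op opP] := choice Luniq.
have opL x : L (op x) by have [[]] := opP x.
have op_up x : op x @` F = up x by have [[]] := opP x.
have op_eq x phi : L phi -> phi @` F = up x -> op x = phi.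
  by move=> Lphi e; have [_] := opP x; apply.
have opA : associative op.
  move=> x y z; have Lxy := Lcomp _ _ (opL x) (opL y).
  have [w ew] := Lup _ Lxy; rewrite (_ : op (op x y) = op x \o op y) //.
  apply: op_eq => //; rewrite ew.
  (* The composite sends [F] onto the image under [op x] of [up y]. *)
  have := ew; rewrite -image_comp op_up => /image_up_least -> //.
  exact: Lmono.
have le_op x y : x <= y <-> exists s, F s /\ op x s = y.
  split=> [xy|[s [Fs <-]]].
    have [s Fs e] : (op x @` F) y by rewrite op_up.
    by exists s.
  by have : up x (op x s) by rewrite -op_up; exists s.
exists (semigroup_of opA), F, id; split.
- move=> s t Fs Ft; apply: (Fup s) => //.
  by apply/le_op; exists t.
- split; last exact: le_op.
    split=> [x|x y z /le_op xy /le_op yz|x y /le_op xy /le_op yx].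
    + exact/le_op.
    + exact/le_op/(le_trans xy).
    + by apply/le_anti/andP.
  by exists id.
- by rewrite image_id.
- apply/seteqP; split=> [psi [phi Lphi]|_ [x _ <-]].
    have [x ex] := Lup _ Lphi => /= e.
    by exists x => //; rewrite (_ : psi = phi) // -(op_eq _ _ Lphi ex).
  by exists (op x).
Qed.

End Posets.

Theorem theorem2p4 (d : Order.disp_t) (P : porderType d) :
  [/\ (exists (T : semigroupType) (S : set T),
         subsemigroup S /\ exists f : P -> T, cayley_iso S f)
      <->
      (exists (L : set (P -> P)) (F : set P), representing L F),
      forall (T : semigroupType) (S : set T) (f : P -> T),
        subsemigroup S -> cayley_iso S f ->
        exists (L : set (P -> P)) (F : set P),
          [/\ representing L F, S = f @` F & transport f L = left_muls T]
    & forall (L : set (P -> P)) (F : set P),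
        representing L F ->
        exists (T : semigroupType) (S : set T) (f : P -> T),
          [/\ subsemigroup S, cayley_iso S f,
              S = f @` F & transport f L = left_muls T]].
Proof.
split; [split | by move=> T S f; exact: left_mul_representing
  | by move=> L F; exact: representing_semigroup].
- move=> [T [S [Ssub [f f_iso]]]].
  by have [L [F []]] := left_mul_representing Ssub f_iso; exists L, F.
- move=> [L [F /representing_semigroup[T [S [f [Ssub f_iso _ _]]]]]].
  by exists T, S; split=> //; exists f.
Qed.
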